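(* Let $G=(V,E)$ be a finite undirected graph with $n=|V|$, let $d:E\to\mathbb{R}^+$, let $k,\alpha\ge2$ be integers, and put $\beta=n-(k-1)\alpha$. For every integer $\ell\ne\alpha$ such that $\left\lceil\frac{n}{k}\right\rceil\le\ell\le\beta$, the inequality $$\sum_{f\in H(\ell)}x_f\ \le\ \left\lfloor\frac{n-k\alpha}{\ell-\alpha}\right\rfloor$$ is valid for the model $(\mathcal{M}_3)$, where $H(\ell)$ is the set of members of $\mathcal{F}$ having exactly $\ell$ nodes.
   Context: $\mathcal{F}$ is the finite family of all induced connected subgraphs of $G$ (identified with their node sets) with number of nodes between $\alpha$ and $\beta$; $|f|$ is the number of nodes of $f\in\mathcal{F}$. For $i\in V$ and $f\in\mathcal{F}$, $a_{if}=1$ if $f$ contains node $i$ and $a_{if}=0$ otherwise; $c_f\ge0$ is the total cost (under $d$) of the edges of $f$. Model $(\mathcal{M}_3)$: minimize $\sum_{f\in\mathcal{F}}c_fx_f$ subject to $\sum_{f\in\mathcal{F}}a_{if}x_f=1$ for all $i\in V$; $\sum_{f\in\mathcal{F}}x_f=k$; $x_f\in\{0,1\}$ for all $f\in\mathcal{F}$. An inequality is valid for the model if every feasible solution of the model satisfies it. *)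

(* Defs.v *)
From HB Require Import structures.
From mathcomp Require Import all_boot all_order all_algebra.
From mathcomp Require Import reals.

Set Implicit Arguments.
Unset Strict Implicit.
Unset Printing Implicit Defensive.

Import Order.TTheory GRing.Theory Num.Theory.
Local Open Scope ring_scope.

Record graph (V : finType) := Graph {
  edges : {set {set V}};
  edges_card2 : forall e, e \in edges -> #|e| = 2
}.

Definition edge (V : finType) (G : graph V) : finType :=
  {e : {set V} | e \in edges G}.

(* Irreflexive because [set x; x] has one element. *)
Definition adj (V : finType) (G : graph V) : rel V :=
  [rel x y | [set x; y] \in edges G].

Definition induced_connected (V : finType) (G : graph V) (f : {set V}) : bool :=
  (f != set0) &&
  [forall x in f, forall y in f,
     connect [rel u v | [&& u \in f, v \in f & adj G u v]] x y].

(* Induced subgraphs are identified with their node sets. The bounds are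
   integers since beta = n - (k - 1) * alpha may be negative. *)
Definition family (V : finType) (G : graph V) (alpha beta : int) :
    {set {set V}} :=
  [set f | induced_connected G f && (alpha <= #|f|%:Z <= beta)].

Definition member (V : finType) (G : graph V) (alpha beta : int) : finType :=
  {f : {set V} | f \in family G alpha beta}.

Definition incidence (R : realType) (V : finType) (G : graph V)
    (alpha beta : int) (i : V) (f : member G alpha beta) : R :=
  (i \in val f)%:R.

Definition cost (R : realType) (V : finType) (G : graph V) (d : edge G -> R)
    (alpha beta : int) (f : member G alpha beta) : R :=
  \sum_(e : edge G | val e \subset val f) d e.

Record min_problem (R : realType) (X : Type) := MinProblem {
  objective : X -> R;
  feasible : X -> Prop
}.

Definition M3 (R : realType) (V : finType) (G : graph V) (d : edge G -> R)
    (k alpha beta : int) : min_problem R (member G alpha beta -> R) :=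
  MinProblem
    (fun x => \sum_(f : member G alpha beta) cost d f * x f)
    (fun x =>
      [/\ forall i : V,
            \sum_(f : member G alpha beta) incidence R i f * x f = 1,
          \sum_(f : member G alpha beta) x f = k%:~R
        & forall f : member G alpha beta, x f = 0 \/ x f = 1]).

Definition valid_inequality (R : realType) (X : Type) (P : min_problem R X)
    (lhs : X -> R) (rhs : R) : Prop :=
  forall x : X, feasible P x -> lhs x <= rhs.

Definition Hset (V : finType) (G : graph V) (alpha beta l : int) :
    {set member G alpha beta} :=
  [set f : member G alpha beta | #|val f|%:Z == l].

(* Main.v *)
(** Summing the covering constraints over all nodes gives
    [sum_f |f| x_f = n]; subtracting [alpha] times the cardinality constraint
    yields [sum_f (|f| - alpha) x_f = n - k alpha], a sum of nonnegative terms
    of which those in [H(l)] contribute [(l - alpha) sum_{f in H(l)} x_f].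
    Feasibility forces [k alpha <= n <= k l], so [l - alpha > 0] and one can
    divide; integrality of [x] then allows rounding down. *)
Require Import Defs.
From HB Require Import structures.
From mathcomp Require Import all_boot all_order all_algebra.
From mathcomp Require Import reals.

Set Implicit Arguments.
Unset Strict Implicit.
Unset Printing Implicit Defensive.

Import Order.TTheory GRing.Theory Num.Theory.
Local Open Scope ring_scope.

(** Double counting: [#|V|] is a sum of ones, each replaced by its covering constraint, and after
    exchanging sums the incidences of [f] add up to [#|val f|]. *)
Lemma sum_card_feasible (R : realType) (V : finType) (G : graph V)
    (d : edge G -> R) (k alpha beta : int) (x : member G alpha beta -> R) :
  feasible (M3 d k alpha beta) x ->
  \sum_(f : member G alpha beta) #|val f|%:R * x f = #|V|%:R.
Proof.
move=> [cover _ _].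
transitivity (\sum_(i : V) (1 : R)); last by rewrite sumr_const.
under [RHS]eq_bigr => i _ do rewrite -(cover i).
rewrite exchange_big; apply: eq_bigr => f _ /=.
rewrite -mulr_suml -sum1_card natr_sum big_mkcond; congr (_ * _).
by apply: eq_bigr => i _; rewrite /incidence; case: (i \in _).
Qed.

Lemma sum_excess_feasible (R : realType) (V : finType) (G : graph V)
    (d : edge G -> R) (k alpha beta : int) (x : member G alpha beta -> R) :
  feasible (M3 d k alpha beta) x ->
  \sum_(f : member G alpha beta) (#|val f|%:Z - alpha)%:~R * x f
  = (#|V|%:Z - k * alpha)%:~R.
Proof.
move=> hx; have [_ sum_x _] := hx.
under eq_bigr => f _ do rewrite intrB mulrBl.
by rewrite sumrB -mulr_sumr sum_x (sum_card_feasible hx) intrB intrM [_ * k%:~R]mulrC.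
Qed.

Lemma excess_ge0 (V : finType) (G : graph V) (alpha beta : int)
    (f : member G alpha beta) : 0 <= #|val f|%:Z - alpha.
Proof.
by have := valP f; rewrite inE => /andP[_ /andP[le_alpha _]]; rewrite subr_ge0.
Qed.

Theorem theorem11 (R : realType) (V : finType) (G : graph V)
    (d : edge G -> R) (hd : forall e : edge G, 0 <= d e)
    (k alpha : int) (hk : 2 <= k) (halpha : 2 <= alpha)
    (beta : int) (hbeta : beta = #|V|%:Z - (k - 1) * alpha)
    (l : int) (hl : l != alpha)
    (hl_lo : Num.ceil (#|V|%:R / k%:~R : R) <= l) (hl_hi : l <= beta) :
  valid_inequality (M3 d k alpha beta)
    (fun x => \sum_(f in Hset G alpha beta l) x f)
    (Num.floor ((#|V|%:Z - k * alpha)%:~R / (l - alpha)%:~R : R))%:~R.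
Proof.
move=> x hx; have [_ _ x01] := hx.
have x_ge0 f : 0 <= x f by case: (x01 f) => ->.
have term_ge0 (f : member G alpha beta) : 0 <= (#|val f|%:Z - alpha)%:~R * x f.
  by rewrite mulr_ge0 // ler0z excess_ge0.
have sumE := sum_excess_feasible hx.
have n_ge : k * alpha <= #|V|%:Z by rewrite -subr_ge0 -(ler0z R) -sumE sumr_ge0.
have k_gt0 : 0 < k by apply: lt_le_trans hk.
have n_le : #|V|%:Z <= k * l.
  move: hl_lo; rewrite ceil_le_int ler_pdivrMr ?ltr0z // -intrM.
  by rewrite -[#|V|%:R]/(#|V|%:Z%:~R) ler_int mulrC.
(* Cancelling [k] in [k * alpha <= k * l] gives only [alpha <= l]; [hl] makes it strict. *)
have l_gt : 0 < l - alpha.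
  rewrite subr_gt0 lt_def hl /=.
  by rewrite -(ler_pM2l k_gt0) (le_trans n_ge n_le).
have sum_int : \sum_(f in Hset G alpha beta l) x f \is a Num.int.
  by apply: rpred_sum => f _; case: (x01 f) => ->; rewrite ?rpred0 ?rpred1.
(* An integral sum is its own floor, so monotonicity of the floor leaves the unrounded bound. *)
rewrite -(floorK sum_int) ler_int le_floor // ler_pdivlMr ?ltr0z //.
(* Termwise comparison: equality on [Hset], and [0] against a nonnegative term elsewhere. *)
rewrite -sumE mulrC mulr_sumr big_mkcond ler_sum //= => f _.
case: ifP => [|_]; last exact: term_ge0.
by rewrite inE => /eqP <-.
Qed.
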